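(* $$\frac{1}{2G}=\mathrm{CF}\left[3n^2+3n+1,\,-2n^4\right],$$ where $G$ is Catalan's constant.
   Context: For sequences $(a_n)_{n\ge0}$, $(b_n)_{n\ge1}$, $\mathrm{CF}[a_n,b_n]$ denotes the continued fraction $a_0+\cfrac{b_1}{a_1+\cfrac{b_2}{a_2+\ddots}}$, whose value is $\lim_{n\to\infty}A_n/B_n$, where $A_0=1$, $A_1=a_0$, $B_0=0$, $B_1=1$, and $A_{n+1}=a_nA_n+b_nA_{n-1}$, $B_{n+1}=a_nB_n+b_nB_{n-1}$ for $n\ge1$. Catalan's constant is $G=\sum_{k=0}^\infty \frac{(-1)^k}{(2k+1)^2}$. *)

(* Defs.v *)
From Stdlib Require Import Reals.
From Coquelicot Require Import Coquelicot.
Open Scope R_scope.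

(** [b] is only used at indices [n >= 1]. *)
Fixpoint CF_num (a b : nat -> R) (n : nat) : R :=
  match n with
  | O => 1
  | S m => match m with
           | O => a O
           | S p => a m * CF_num a b m + b m * CF_num a b p
           end
  end.

Fixpoint CF_den (a b : nat -> R) (n : nat) : R :=
  match n with
  | O => 0
  | S m => match m with
           | O => 1
           | S p => a m * CF_den a b m + b m * CF_den a b p
           end
  end.

(** [is_CF a b v]: the continued fraction CF[a_n, b_n] converges with value [v].
    Division on [R] is total, so the first conjunct demands that the quotients
    [A_n / B_n] are genuinely defined for all large [n] ([B_0 = 0] always). *)
Definition is_CF (a b : nat -> R) (v : R) : Prop :=
  eventually (fun n => CF_den a b n <> 0) /\
  is_lim_seq (fun n => CF_num a b n / CF_den a b n) v.

Definition Catalan : R :=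
  Series (fun k => (-1) ^ k / (2 * INR k + 1) ^ 2).

(* Main.v *)
(** Substituting [A_n = n!^2 u_n] turns the recurrence into
    (n+1)^2 u_(n+1) = (3n^2+3n+1) u_n - 2n^2 u_(n-1).  Its solutions grow
    geometrically, except for the bounded one J_n = sum_j t(n,j), where
    t(n,j) = c_j^2 n! (2j)! / (n+2j+1)! and c_j = binomial(2j,j) / 4^j (up to a
    constant, J_n is the integral over [0,1] of (1-s)^n times the complete
    elliptic integral K(s)).  With w = lim j c_j^2 one has J_0 = 4wG and
    J_1 = J_0 - 2w, so J_n n!^2 = 2w (2G A_n - B_n), and J_n / u_n -> 0 gives
    B_n / A_n -> 2G.

    For J_0 = 4wG, put p_m(j) = binomial(2j,j-m) / 4^j and
    S_m = sum_j c_j p_m(j) / (2j+1).  The series for S_m + S_(m+1) telescopes to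
    4w / (2m+1)^2, so S_m -> 0 and S_0 = J_0 is 4w times the Catalan series. *)

Require Import Defs.
From Stdlib Require Import Reals.
From Coquelicot Require Import Coquelicot.
From Stdlib Require Import Arith Lra Lia.
Open Scope R_scope.

(** * Central binomial weights and their asymptotic constant w *)

(* binomial(2j, j) / 4^j *)
Fixpoint cbin (j : nat) : R :=
  match j with
  | O => 1
  | S i => cbin i * ((2 * INR i + 1) / (2 * INR i + 2))
  end.

Lemma cbin_pos j : 0 < cbin j.
Proof.
  induction j as [|j IH]; simpl; [lra|].
  pose proof (pos_INR j).
  apply Rmult_lt_0_compat; [exact IH|].
  apply Rdiv_lt_0_compat; lra.
Qed.

Lemma cbin_sq_le j : (2 * INR j + 1) * cbin j ^ 2 <= 1.
Proof.
  induction j as [|j IH]; [simpl; lra|].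
  rewrite S_INR; simpl cbin.
  pose proof (pos_INR j); pose proof (cbin_pos j).
  apply Rle_trans with (2 := IH).
  replace ((2 * (INR j + 1) + 1) * (cbin j * ((2 * INR j + 1) / (2 * INR j + 2))) ^ 2)
    with ((2 * INR j + 1) * cbin j ^ 2
          * ((2 * INR j + 3) * (2 * INR j + 1) / (2 * INR j + 2) ^ 2)) by (field; lra).
  rewrite <- (Rmult_1_r ((2 * INR j + 1) * cbin j ^ 2)) at 2.
  apply Rmult_le_compat_l; [nra|].
  apply Rle_div_l; nra.
Qed.

Lemma cbin_sq_step j :
  INR (S j) * cbin (S j) ^ 2 - INR j * cbin j ^ 2 = cbin j ^ 2 / (4 * (INR j + 1)).
Proof.
  rewrite S_INR; simpl cbin; pose proof (pos_INR j); field; lra.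
Qed.

(** Wallis's product in disguise: w is 1/pi. The sequence increases by [cbin_sq_step] and stays
    below 1 by [cbin_sq_le]; w is carried as a symbol that cancels from the final quotient. *)
Lemma ex_lim_cbin :
  exists w : R, 0 < w /\ is_lim_seq (fun j => INR j * cbin j ^ 2) w.
Proof.
  assert (Hincr : forall j, INR j * cbin j ^ 2 <= INR (S j) * cbin (S j) ^ 2).
  { intros j; pose proof (cbin_sq_step j); pose proof (pos_INR j).
    assert (0 <= cbin j ^ 2 / (4 * (INR j + 1))); [|lra].
    apply Rdiv_le_0_compat; [apply pow2_ge_0|lra]. }
  destruct (ex_finite_lim_seq_incr (fun j => INR j * cbin j ^ 2) 1 Hincr) as [w Hw].
  { intros j; pose proof (cbin_sq_le j); pose proof (pos_INR j); nra. }
  exists w; split; [|exact Hw].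
  (* The increasing sequence already equals 1/4 at j = 1, hence w > 0. *)
  pose proof (is_lim_seq_incr_compare _ _ Hw Hincr 1) as H1.
  simpl in H1; lra.
Qed.

(* [is_series_ext] leaves equations in a structure's carrier, which [field] rejects. *)
Lemma is_series_Rext (u v : nat -> R) (l : R) :
  (forall n, u n = v n) -> is_series u l -> is_series v l.
Proof. exact (is_series_ext u v l). Qed.

Lemma is_series_telescope (k : R) (u : nat -> R) (l : R) :
  is_lim_seq u l -> is_series (fun j => k * (u (S j) - u j)) (k * (l - u O)).
Proof.
  intros Hu.
  change (is_lim_seq (sum_n (fun j => k * (u (S j) - u j))) (k * (l - u O))).
  apply is_lim_seq_ext with (fun n => k * (u (S n) - u O)).
  { intros n; induction n as [|n IH].
    - rewrite sum_O; reflexivity.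
    - rewrite sum_Sn, <- IH; unfold plus; simpl; ring. }
  apply is_lim_seq_mult'; [apply is_lim_seq_const|].
  apply is_lim_seq_minus'; [|apply is_lim_seq_const].
  now apply is_lim_seq_incr_1 in Hu.
Qed.

(** * Off-central binomials and the Catalan series *)

(* [cbin_off m j] is binomial(2j, j - m) / 4^j, and vanishes for m > j. *)
Fixpoint cbin_off (m j : nat) : R :=
  match m with
  | O => cbin j
  | S k => cbin_off k j * ((INR j - INR k) / (INR j + INR k + 1))
  end.

Lemma cbin_off_gt m j : (j < m)%nat -> cbin_off m j = 0.
Proof.
  induction m as [|m IH]; intros H; [lia|]; simpl.
  destruct (Nat.eq_dec j m) as [->|].
  - unfold Rdiv; ring.
  - rewrite IH by lia; ring.
Qed.

Lemma cbin_off_bounds m j : 0 <= cbin_off m j <= cbin j.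
Proof.
  induction m as [|m IH]; [simpl; pose proof (cbin_pos j); lra|].
  destruct (Nat.lt_ge_cases j (S m)) as [H|H].
  { rewrite cbin_off_gt by exact H; pose proof (cbin_pos j); lra. }
  simpl.
  assert (Hm : INR m <= INR j) by (apply le_INR; lia).
  pose proof (pos_INR m).
  assert (0 <= (INR j - INR m) / (INR j + INR m + 1) <= 1).
  { split; [apply Rdiv_le_0_compat; lra | apply Rle_div_l; lra]. }
  split; nra.
Qed.

(** Denominators are cleared because j + 1 - m vanishes at m = j + 1, where both sides are 0. *)
Lemma cbin_off_succ m j :
  cbin_off m (S j) * (2 * (INR j + 1 - INR m) * (INR j + 1 + INR m))
  = cbin_off m j * ((2 * INR j + 1) * (INR j + 1)).
Proof.
  pose proof (pos_INR j).
  induction m as [|m IH].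
  - simpl; field; lra.
  - change (cbin_off (S m) (S j))
      with (cbin_off m (S j) * ((INR (S j) - INR m) / (INR (S j) + INR m + 1))).
    change (cbin_off (S m) j)
      with (cbin_off m j * ((INR j - INR m) / (INR j + INR m + 1))).
    rewrite !S_INR; pose proof (pos_INR m).
    transitivity ((INR j - INR m) / (INR j + INR m + 1) *
      (cbin_off m (S j) * (2 * (INR j + 1 - INR m) * (INR j + 1 + INR m)))).
    + field; lra.
    + rewrite IH; field; lra.
Qed.

(** Passing from m to m + 1 multiplies the sequence by (j - m - 1)/(j + m + 1), which tends to 1. *)
Lemma is_lim_seq_cbin_off (w : R) m :
  is_lim_seq (fun j => INR j * cbin j ^ 2) w ->
  is_lim_seq (fun j => (INR j - INR m) * cbin j * cbin_off m j) w.
Proof.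
  intros Hw; induction m as [|m IH].
  { apply is_lim_seq_ext with (2 := Hw); intros j; simpl; ring. }
  pose proof (pos_INR m).
  apply is_lim_seq_ext with
    (fun j => (INR j - INR m) * cbin j * cbin_off m j
              * (1 - (2 * INR m + 2) * / (INR j + (INR m + 1)))).
  { intros j; pose proof (pos_INR j); rewrite S_INR; simpl; field; lra. }
  replace (Finite w) with (Finite (w * (1 - (2 * INR m + 2) * 0)))
    by (f_equal; ring).
  apply is_lim_seq_mult'; [exact IH|].
  apply is_lim_seq_minus'; [apply is_lim_seq_const|].
  apply is_lim_seq_mult'; [apply is_lim_seq_const|].
  apply (is_lim_seq_inv _ p_infty).
  - apply (is_lim_seq_plus _ _ p_infty (INR m + 1) p_infty).
    + apply is_lim_seq_INR.
    + apply is_lim_seq_const.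
    + reflexivity.
  - discriminate.
Qed.

(** Gosper summation: the term is 4/(2m+1)^2 times the increment of (j - m) c_j p_m(j), because
    (2j+1)^2 - 4(j-m)(j+m+1) = (2m+1)^2. *)
Lemma is_series_cbin_off (w : R) m :
  is_lim_seq (fun j => INR j * cbin j ^ 2) w ->
  is_series (fun j => cbin j * cbin_off m j / (INR j + INR m + 1))
    (4 * w / (2 * INR m + 1) ^ 2).
Proof.
  intros Hw; pose proof (pos_INR m).
  pose proof (is_series_telescope (4 / (2 * INR m + 1) ^ 2) _ _
    (is_lim_seq_cbin_off w m Hw)) as HS.
  cbv beta in HS.
  (* The boundary term at j = 0 vanishes: through the factor j - m if m = 0, through p_m(0) = 0
     otherwise. *)
  replace (w - (INR 0 - INR m) * cbin 0 * cbin_off m 0) with w in HS.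
  2:{ destruct m as [|m]; [simpl; ring | rewrite cbin_off_gt by lia; ring]. }
  replace (4 * w / (2 * INR m + 1) ^ 2) with (4 / (2 * INR m + 1) ^ 2 * w)
    by (field; lra).
  apply is_series_Rext with (2 := HS).
  intros j; pose proof (pos_INR j).
  replace ((INR (S j) - INR m) * cbin (S j) * cbin_off m (S j))
    with (cbin j * (2 * INR j + 1) / (4 * (INR j + 1) * (INR j + 1 + INR m))
      * (cbin_off m (S j) * (2 * (INR j + 1 - INR m) * (INR j + 1 + INR m))))
    by (rewrite S_INR; simpl cbin; field; lra).
  rewrite cbin_off_succ; field; lra.
Qed.

Lemma ex_series_cbin_off (w : R) m :
  is_lim_seq (fun j => INR j * cbin j ^ 2) w ->
  ex_series (fun j => cbin j * cbin_off m j / (2 * INR j + 1)).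
Proof.
  intros Hw.
  apply (ex_series_le (K := R_AbsRing) (V := R_CompleteNormedModule) _
    (fun j => cbin j * cbin_off 0 j / (INR j + INR 0 + 1))).
  2:{ eexists; apply is_series_cbin_off; exact Hw. }
  intros j; pose proof (pos_INR j); pose proof (cbin_off_bounds m j);
    pose proof (cbin_pos j).
  unfold norm; simpl; unfold abs; simpl.
  assert (0 <= cbin j * cbin_off m j) by nra.
  rewrite Rabs_pos_eq by (apply Rdiv_le_0_compat; lra).
  apply Rmult_le_compat; try nra.
  - apply Rlt_le, Rinv_0_lt_compat; lra.
  - apply Rinv_le_contravar; lra.
Qed.

Lemma Series_ge_0 (u : nat -> R) :
  (forall n, 0 <= u n) -> ex_series u -> 0 <= Series u.
Proof.
  intros H Hu; rewrite <- (Rmult_0_l (Series u)), <- Series_scal_l.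
  apply Series_le; [|exact Hu].
  intros n; pose proof (H n); lra.
Qed.

(** Since p_m + p_(m+1) = p_m (2j+1)/(j+m+1), the denominator 2j + 1 cancels and the Gosper-summable
    series remains. *)
Lemma Series_cbin_off_add (w : R) m :
  is_lim_seq (fun j => INR j * cbin j ^ 2) w ->
  Series (fun j => cbin j * cbin_off m j / (2 * INR j + 1))
  + Series (fun j => cbin j * cbin_off (S m) j / (2 * INR j + 1))
  = 4 * w / (2 * INR m + 1) ^ 2.
Proof.
  intros Hw.
  rewrite <- Series_plus by (eapply ex_series_cbin_off; exact Hw).
  apply is_series_unique.
  apply is_series_Rext with (2 := is_series_cbin_off w m Hw).
  intros j; pose proof (pos_INR j); pose proof (pos_INR m); simpl; field; lra.
Qed.

Lemma Series_cbin_Catalan (w : R) :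
  is_lim_seq (fun j => INR j * cbin j ^ 2) w ->
  Series (fun j => cbin j ^ 2 / (2 * INR j + 1)) = 4 * w * Catalan.
Proof.
  intros Hw.
  set (s := fun m => Series (fun j => cbin j * cbin_off m j / (2 * INR j + 1))).
  assert (Hadd : forall m, s m + s (S m) = 4 * w / (2 * INR m + 1) ^ 2)
    by (intros m; now apply Series_cbin_off_add).
  assert (Hpos : forall m, 0 <= s m).
  { intros m; apply Series_ge_0; [|eapply ex_series_cbin_off; exact Hw].
    intros j; pose proof (pos_INR j); pose proof (cbin_off_bounds m j);
      pose proof (cbin_pos j).
    apply Rdiv_le_0_compat; nra. }
  assert (Hdec : is_lim_seq (fun m => 4 * w / (2 * INR m + 1) ^ 2) 0).
  { apply is_lim_seq_ext with
      (fun m => 4 * w * (/ (2 * INR m + 1) * / (2 * INR m + 1))).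
    { intros m; pose proof (pos_INR m); field; lra. }
    assert (is_lim_seq (fun m => / (2 * INR m + 1)) 0).
    { apply (is_lim_seq_inv _ p_infty); [|discriminate].
      apply (is_lim_seq_plus _ _ p_infty 1 p_infty);
        [|apply is_lim_seq_const|reflexivity].
      apply is_lim_seq_le_p_loc with INR; [|apply is_lim_seq_INR].
      exists O; intros n _; pose proof (pos_INR n); lra. }
    replace (Finite 0) with (Finite (4 * w * (0 * 0))) by (f_equal; ring).
    apply is_lim_seq_mult'; [apply is_lim_seq_const|now apply is_lim_seq_mult']. }
  (* Nonnegativity gives s_m <= s_m + s_(m+1), which tends to 0. *)
  assert (Hlim : is_lim_seq (fun m => (-1) ^ m * s m) 0).
  { apply is_lim_seq_abs_0.
    apply is_lim_seq_le_le with (2 := is_lim_seq_const 0) (3 := Hdec).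
    intros m; rewrite Rabs_mult, pow_1_abs, Rmult_1_l, Rabs_pos_eq by apply Hpos.
    pose proof (Hadd m); pose proof (Hpos m); pose proof (Hpos (S m)); lra. }
  (* Minus the increment of (-1)^m s_m is (-1)^m (s_m + s_(m+1)), that is, 4w times a term of the
     Catalan series. *)
  apply (is_series_telescope (-1)), is_series_unique in Hlim.
  replace (-1 * (0 - (-1) ^ 0 * s O)) with (s O) in Hlim by (simpl; ring).
  transitivity (s O).
  { apply Series_ext; intros j; simpl; f_equal; ring. }
  rewrite <- Hlim; unfold Catalan; rewrite <- Series_scal_l.
  apply Series_ext; intros m; simpl pow at 1.
  transitivity ((-1) ^ m * (s m + s (S m))); [ring|].
  rewrite Hadd; pose proof (pos_INR m); field; lra.
Qed.

(** * The sums J_n and their recurrence *)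

(* [beta_term n j] is the square of [cbin j] times the integral of
   (1 - s)^n s^(2j) over [0, 1]. *)
Fixpoint beta_term (n j : nat) : R :=
  match n with
  | O => cbin j ^ 2 / (2 * INR j + 1)
  | S k => beta_term k j * (INR (S k) / (INR (S k) + 2 * INR j + 1))
  end.

Lemma beta_term_S n j :
  beta_term (S n) j = beta_term n j * (INR (S n) / (INR (S n) + 2 * INR j + 1)).
Proof. reflexivity. Qed.

Lemma beta_term_pos n j : 0 < beta_term n j.
Proof.
  pose proof (pos_INR j).
  induction n as [|n IH].
  - apply Rdiv_lt_0_compat; [apply (pow_lt _ 2), cbin_pos | lra].
  - rewrite beta_term_S; apply Rmult_lt_0_compat; [exact IH|].
    rewrite S_INR; pose proof (pos_INR n); apply Rdiv_lt_0_compat; lra.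
Qed.

Lemma beta_term_le n j : beta_term n j <= beta_term 0 j.
Proof.
  pose proof (pos_INR j).
  induction n as [|n IH]; [apply Rle_refl|].
  apply Rle_trans with (2 := IH).
  rewrite beta_term_S, S_INR; pose proof (pos_INR n); pose proof (beta_term_pos n j).
  assert ((INR n + 1) / (INR n + 1 + 2 * INR j + 1) <= 1)
    by (apply Rle_div_l; lra).
  nra.
Qed.

Lemma beta_term_succ n j :
  beta_term n (S j)
  = beta_term n j * (2 * INR j + 1) ^ 3
    / ((2 * INR j + 2) * (INR n + 2 * INR j + 2) * (INR n + 2 * INR j + 3)).
Proof.
  pose proof (pos_INR j).
  induction n as [|n IH].
  - change (INR 0) with 0; cbn [beta_term cbin]; rewrite S_INR; field; lra.
  - rewrite !beta_term_S, IH, !S_INR; pose proof (pos_INR n).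
    field; lra.
Qed.

Lemma ex_series_beta (w : R) n :
  is_lim_seq (fun j => INR j * cbin j ^ 2) w -> ex_series (beta_term n).
Proof.
  intros Hw.
  apply (ex_series_le (K := R_AbsRing) (V := R_CompleteNormedModule) _ (beta_term 0)).
  - intros j; unfold norm; simpl; unfold abs; simpl.
    rewrite Rabs_pos_eq by apply Rlt_le, beta_term_pos.
    apply beta_term_le.
  - apply ex_series_ext with (2 := ex_series_cbin_off w 0 Hw).
    intros j; simpl; f_equal; ring.
Qed.

Lemma Series_beta_0 (w : R) :
  is_lim_seq (fun j => INR j * cbin j ^ 2) w ->
  Series (beta_term 0) = 4 * w * Catalan.
Proof. exact (Series_cbin_Catalan w). Qed.

(** The termwise difference is c_j^2/(2j+2), twice the increment of j c_j^2 given by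
    [cbin_sq_step]. *)
Lemma Series_beta_1 (w : R) :
  is_lim_seq (fun j => INR j * cbin j ^ 2) w ->
  Series (beta_term 1) = Series (beta_term 0) - 2 * w.
Proof.
  intros Hw.
  assert (H : is_series (fun j => beta_term 0 j - beta_term 1 j) (2 * w)).
  { pose proof (is_series_telescope 2 _ _ Hw) as HS; cbv beta in HS.
    replace (2 * (w - INR 0 * cbin 0 ^ 2)) with (2 * w) in HS by (simpl; ring).
    apply is_series_Rext with (2 := HS).
    intros j; rewrite cbin_sq_step.
    pose proof (pos_INR j); simpl; field; lra. }
  apply is_series_unique in H.
  rewrite Series_minus in H by (eapply ex_series_beta; exact Hw).
  lra.
Qed.

(** This removes the boundary term at infinity when the certificate of [Series_beta_rec] is
    telescoped. *)
Lemma is_lim_seq_beta (w : R) n :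
  is_lim_seq (fun j => INR j * cbin j ^ 2) w ->
  is_lim_seq (fun j => INR j * beta_term n j) 0.
Proof.
  intros Hw.
  apply is_lim_seq_le_le_loc with (fun _ => 0) (fun j => INR j * cbin j ^ 2 * / INR j).
  - exists 1%nat; intros j Hj.
    assert (1 <= INR j) by (apply (le_INR 1); exact Hj).
    pose proof (beta_term_pos n j); pose proof (beta_term_le n j).
    split; [nra|].
    apply Rle_trans with (INR j * beta_term 0 j); [nra|].
    change (beta_term 0 j) with (cbin j ^ 2 / (2 * INR j + 1)).
    replace (INR j * cbin j ^ 2 * / INR j)
      with (INR j * (cbin j ^ 2 / INR j)) by (field; lra).
    apply Rmult_le_compat_l; [lra|].
    apply Rmult_le_compat_l; [apply pow2_ge_0|].
    apply Rinv_le_contravar; lra.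
  - apply is_lim_seq_const.
  - replace (Finite 0) with (Finite (w * 0)) by (f_equal; ring).
    apply is_lim_seq_mult'; [exact Hw|].
    apply (is_lim_seq_inv _ p_infty); [apply is_lim_seq_INR|discriminate].
Qed.

(* Zeilberger's recurrence, with certificate -(n + 1) 2j beta_term n j. *)
Lemma Series_beta_rec (w : R) n :
  is_lim_seq (fun j => INR j * cbin j ^ 2) w ->
  (INR n + 2) ^ 2 * Series (beta_term (S (S n)))
  = (3 * INR (S n) ^ 2 + 3 * INR (S n) + 1) * Series (beta_term (S n))
    - 2 * INR (S n) ^ 2 * Series (beta_term n).
Proof.
  intros Hw.
  pose proof (is_series_telescope (-2 * (INR n + 1)) _ _ (is_lim_seq_beta w n Hw)) as HS.
  apply is_series_unique in HS.
  replace (-2 * (INR n + 1) * (0 - INR 0 * beta_term n 0)) with 0 in HS by (simpl; ring).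
  assert (Hex : forall k, ex_series (beta_term k))
    by (intros k; eapply ex_series_beta; exact Hw).
  rewrite (Series_ext _ (fun j =>
    (INR n + 2) ^ 2 * beta_term (S (S n)) j
    - (3 * INR (S n) ^ 2 + 3 * INR (S n) + 1) * beta_term (S n) j
    + 2 * INR (S n) ^ 2 * beta_term n j)) in HS.
  - rewrite Series_plus, Series_minus, !Series_scal_l in HS; [lra|..].
    all: repeat first [apply Hex | apply (ex_series_minus (V := R_NormedModule))
      | apply (ex_series_scal (V := R_NormedModule))].
  - intros j; rewrite beta_term_succ.
    rewrite !beta_term_S, !S_INR.
    pose proof (pos_INR j); pose proof (pos_INR n); field; lra.
Qed.

(** * Growth of numerators and denominators, and the limit *)

Lemma CF_num_SS a b n :
  CF_num a b (S (S n)) = a (S n) * CF_num a b (S n) + b (S n) * CF_num a b n.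
Proof. reflexivity. Qed.

Lemma CF_den_SS a b n :
  CF_den a b (S (S n)) = a (S n) * CF_den a b (S n) + b (S n) * CF_den a b n.
Proof. reflexivity. Qed.

(** A bound u_(n+1) >= q (n+1)^2 u_n reproduces itself to leading order when 3 - 2/q >= q, that is
    for 1 <= q <= 2. The start A_1 = 1, A_2 = 5 allows q = 5/4 with equality. *)
Lemma rec_growth (u : nat -> R) :
  0 < u 1%nat -> 5 * u 1%nat <= u 2%nat ->
  (forall n, u (S (S n)) = (3 * INR (S n) ^ 2 + 3 * INR (S n) + 1) * u (S n)
                           + - 2 * INR (S n) ^ 4 * u n) ->
  forall n, 0 < u (S n) /\ 5 / 4 * (INR n + 2) ^ 2 * u (S n) <= u (S (S n)).
Proof.
  intros H1 H2 Hrec n; induction n as [|n [IH1 IH2]].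
  { simpl INR; split; lra. }
  pose proof (pos_INR n).
  assert (Hpos : 0 < u (S (S n))) by nra.
  split; [exact Hpos|].
  rewrite (Hrec (S n)), !S_INR.
  set (x := INR n) in *.
  (* The induction hypothesis bounds the negative term; 8/5 is 2/q. *)
  assert (2 * (x + 1 + 1) ^ 4 * u (S n) <= 8 / 5 * (x + 2) ^ 2 * u (S (S n))).
  { replace (2 * (x + 1 + 1) ^ 4 * u (S n))
      with (8 / 5 * (x + 2) ^ 2 * (5 / 4 * (x + 2) ^ 2 * u (S n))) by field.
    apply Rmult_le_compat_l; [nra|exact IH2]. }
  nra.
Qed.

Theorem corollary2p1 :
  is_CF (fun n => 3 * INR n ^ 2 + 3 * INR n + 1)
        (fun n => - 2 * INR n ^ 4)
        (1 / (2 * Catalan)).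
Proof.
  set (a := fun n => 3 * INR n ^ 2 + 3 * INR n + 1).
  set (b := fun n => - 2 * INR n ^ 4).
  destruct ex_lim_cbin as [w [Hw0 Hw]].
  set (A := CF_num a b); set (B := CF_den a b).
  assert (HA : forall n, 0 < A (S n) /\ 5 / 4 * (INR n + 2) ^ 2 * A (S n) <= A (S (S n))).
  { apply rec_growth; [unfold A, a, b; simpl; lra..|].
    intros n; exact (CF_num_SS a b n). }
  assert (HB : forall n, 0 < B (S n) /\ 5 / 4 * (INR n + 2) ^ 2 * B (S n) <= B (S (S n))).
  { apply rec_growth; [unfold B, a, b; simpl; lra..|].
    intros n; exact (CF_den_SS a b n). }
  set (J := fun n => Series (beta_term n)).
  assert (Hex : forall k, ex_series (beta_term k))
    by (intros k; eapply ex_series_beta; exact Hw).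
  assert (HJ : forall n, 0 <= J n <= J O).
  { intros n; split.
    - apply Series_ge_0; [intros j; apply Rlt_le, beta_term_pos | apply Hex].
    - apply Series_le; [|apply Hex]; intros j.
      split; [apply Rlt_le, beta_term_pos | apply beta_term_le]. }
  assert (HG : 0 < Catalan).
  { assert (0 < J O).
    { unfold J; rewrite Series_incr_1 by apply Hex.
      pose proof (beta_term_pos 0 0).
      assert (0 <= Series (fun k => beta_term 0 (S k))); [|lra].
      apply Series_ge_0; [intros j; apply Rlt_le, beta_term_pos|].
      apply -> (ex_series_incr_1 (beta_term 0)); apply Hex. }
    assert (J O = 4 * w * Catalan) by now apply Series_beta_0.
    nra. }
  (* Both sides satisfy the same second-order recurrence, so two consecutive indices are carried
     through the induction. *)
  assert (Hlin : forall n,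
    J n * INR (fact n) ^ 2 = 2 * w * (2 * Catalan * A n - B n) /\
    J (S n) * INR (fact (S n)) ^ 2 = 2 * w * (2 * Catalan * A (S n) - B (S n))).
  { induction n as [|n [IH1 IH2]].
    - unfold J; rewrite (Series_beta_1 w Hw), (Series_beta_0 w Hw).
      unfold A, B, a; simpl; split; ring.
    - split; [exact IH2|].
      unfold A, B; rewrite CF_num_SS, CF_den_SS; fold A B.
      transitivity (a (S n) * (J (S n) * INR (fact (S n)) ^ 2)
                    + b (S n) * (J n * INR (fact n) ^ 2)).
      2:{ rewrite IH1, IH2; ring. }
      pose proof (Series_beta_rec w n Hw) as Hrec; fold (J n) (J (S n)) (J (S (S n))) in Hrec.
      rewrite (fact_simpl (S n)), (fact_simpl n), !mult_INR.
      transitivity ((INR n + 2) ^ 2 * J (S (S n)) * (INR (S n) * INR (fact n)) ^ 2).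
      { rewrite !S_INR; ring. }
      rewrite Hrec; unfold a, b; ring. }
  assert (Hgrow : forall n, INR (fact (S n)) ^ 2 * (5 / 4) ^ n <= A (S n)).
  { induction n as [|n IH]; [unfold A, a; simpl; lra|].
    apply Rle_trans with (2 := proj2 (HA n)).
    rewrite fact_simpl, mult_INR, !S_INR.
    replace (((INR n + 1 + 1) * INR (fact (S n))) ^ 2 * (5 / 4) ^ S n)
      with (5 / 4 * (INR n + 2) ^ 2 * (INR (fact (S n)) ^ 2 * (5 / 4) ^ n))
      by (simpl pow; ring).
    apply Rmult_le_compat_l; [pose proof (pos_INR n); nra | exact IH]. }
  assert (Hgeom : is_lim_seq (fun n => J O / (2 * w) * (4 / 5) ^ n) 0).
  { replace (Finite 0) with (Finite (J O / (2 * w) * 0)) by (f_equal; ring).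
    apply is_lim_seq_mult'; [apply is_lim_seq_const|].
    apply is_lim_seq_geom; rewrite Rabs_pos_eq; lra. }
  (* By [Hlin] the error is J_(n+1) (n+1)!^2 / (2w A_(n+1)). It is nonnegative and, by [Hgrow] and
     J_(n+1) <= J_0, at most J_0/(2w) (4/5)^n. *)
  assert (Herr : is_lim_seq (fun n => 2 * Catalan - B (S n) / A (S n)) 0).
  { apply is_lim_seq_le_le with (2 := is_lim_seq_const 0) (3 := Hgeom).
    intros n; destruct (HA n) as [HAn _]; destruct (HJ (S n)) as [HJ1 HJ2].
    assert (Hf : 0 < INR (fact (S n)) ^ 2) by apply pow_lt, INR_fact_lt_0.
    assert (H45 : 0 < (4 / 5) ^ n) by (apply pow_lt; lra).
    replace (2 * Catalan - B (S n) / A (S n))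
      with (J (S n) * INR (fact (S n)) ^ 2 / (2 * w * A (S n)))
      by (rewrite (proj2 (Hlin n)); field; lra).
    assert (0 <= J (S n) * INR (fact (S n)) ^ 2) by nra.
    split; [apply Rdiv_le_0_compat; nra|].
    apply Rle_div_l; [nra|].
    replace (J O / (2 * w) * (4 / 5) ^ n * (2 * w * A (S n)))
      with (J O * ((4 / 5) ^ n * A (S n))) by (field; lra).
    apply Rmult_le_compat; try lra.
    apply Rle_trans with ((4 / 5) ^ n * (INR (fact (S n)) ^ 2 * (5 / 4) ^ n)).
    - replace ((4 / 5) ^ n * (INR (fact (S n)) ^ 2 * (5 / 4) ^ n))
        with (INR (fact (S n)) ^ 2 * ((4 / 5) ^ n * (5 / 4) ^ n)) by ring.
      rewrite <- Rpow_mult_distr.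
      replace (4 / 5 * (5 / 4)) with 1 by field.
      rewrite pow1; lra.
    - apply Rmult_le_compat_l; [lra|apply Hgrow]. }
  split.
  - exists 1%nat; intros [|n] Hn; [lia|].
    apply Rgt_not_eq, (proj1 (HB n)).
  (* The shift skips B_0 = 0, so A/B can be written as the inverse of B/A = 2G - error, whose limit
     2G is nonzero. *)
  - apply is_lim_seq_incr_1.
    apply is_lim_seq_ext with
      (fun n => / (2 * Catalan - (2 * Catalan - B (S n) / A (S n)))).
    { intros n; fold A B; pose proof (proj1 (HA n)); pose proof (proj1 (HB n)).
      field; repeat split; lra. }
    replace (Finite (1 / (2 * Catalan))) with (Rbar_inv (2 * Catalan - 0)).
    2:{ simpl; f_equal; field; lra. }
    apply is_lim_seq_inv.
    + apply is_lim_seq_minus'; [apply is_lim_seq_const|exact Herr].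
    + intros H; apply Rbar_finite_eq in H; lra.
Qed.
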